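(* Let $n\in\mathbb{N}$ and let $x,k$ be integers. (1) If $x$ is odd, $4\le x\le 2n$ and $3\le k\le x-2$, then $$\hat P_{2n+2}(x,k)=\sum_{i=0}^{\lfloor k/2\rfloor-1}P_{n-i}\!\left(\tfrac{x-2i-1}{2},k\right)+\sum_{j=0}^{k}P_{\frac{2n-k+1}{2}}\!\left(\tfrac{x-k}{2},j\right),$$ where the second sum is interpreted as $0$ when $k$ is even. (2) If $x$ is even, $4\le x\le 2n-1$ and $3\le k\le x-2$, then $$\hat P_{2n+1}(x,k)=\sum_{i=0}^{\lfloor (k-1)/2\rfloor}P_{n-i}\!\left(\tfrac{x-2i}{2},k\right)+\sum_{j=0}^{k}P_{\frac{2n-k}{2}}\!\left(\tfrac{x-k}{2},j\right),$$ where the second sum is interpreted as $0$ when $k$ is odd.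
   Context: For a binary string $X$, let $X_l$ be the multiset of lengths of the maximal blocks of consecutive zeros of $X$. For integers $m\ge 0$ and $y,j\ge 0$, $B_m^{y,j}$ denotes the set of binary strings of length $m$ with exactly $y$ zeros and longest block of consecutive zeros of length exactly $j$ (the all-ones string, including the empty string, lies in $B_m^{0,0}$), and $P_{m+1}(y,j)$ denotes the number of distinct multisets $X_l$ with $X\in B_m^{y,j}$ (the number of equivalence classes of $B_m^{y,j}$ under $X\sim Y\iff X_l=Y_l$). Similarly $\hat B_m^{y,j}$ denotes the set of palindromic binary strings (equal to their reversal) of length $m$ with exactly $y$ zeros and longest block of zeros of length exactly $j$, and $\hat P_{m+1}(y,j)$ denotes the number of distinct multisets $X_l$ with $X\in\hat B_m^{y,j}$ (these correspond to palindromic partitions of $m+1$). *)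

(* Defs.v *)
From mathcomp Require Import all_boot.

Set Implicit Arguments.
Unset Strict Implicit.
Unset Printing Implicit Defensive.

(* Binary strings are boolean sequences, with [false] as the digit 0 and
   [true] as the digit 1. *)

(* [zero_blocks_from c s] lists the lengths of the maximal blocks of zeros of
   [nseq c false ++ s]: [c] is the length of the block being read. *)
Fixpoint zero_blocks_from (c : nat) (s : seq bool) : seq nat :=
  match s with
  | [::] => if c == 0 then [::] else [:: c]
  | false :: s' => zero_blocks_from c.+1 s'
  | true :: s' =>
      if c == 0 then zero_blocks_from 0 s' else c :: zero_blocks_from 0 s'
  end.

(* The multiset X_l is this list taken up to [perm_eq]. *)
Definition zero_blocks (s : seq bool) : seq nat := zero_blocks_from 0 s.

Example zero_blocks_ex :
  zero_blocks [:: false; false; true; true; false; true; false; false]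
  = [:: 2; 1; 2].
Proof. by []. Qed.

Definition num_zeros (s : seq bool) : nat := count_mem false s.

Definition longest_zero_block (s : seq bool) : nat :=
  \max_(l <- zero_blocks s) l.

Definition same_blocks (m : nat) : rel (m.-tuple bool) :=
  fun X Y => perm_eq (zero_blocks X) (zero_blocks Y).

Definition B (m y j : nat) : {set m.-tuple bool} :=
  [set X : m.-tuple bool | (num_zeros X == y) && (longest_zero_block X == j)].

Definition Bhat (m y j : nat) : {set m.-tuple bool} :=
  [set X in B m y j | rev X == X :> seq bool].

(* The index is m + 1 for strings of length m, so the value at index 0 is a
   convention only. *)
Definition P (N y j : nat) : nat :=
  if N is m.+1 then #|equivalence_partition (@same_blocks m) (B m y j)| else 0.

Definition Phat (N y j : nat) : nat :=
  if N is m.+1 then #|equivalence_partition (@same_blocks m) (Bhat m y j)|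
  else 0.

(* Main.v *)
Require Import Defs.
From mathcomp Require Import all_boot zify.

(** A palindrome containing a one, whose length and number of zeros have the
    same parity, is [rev h ++ 1 0^c 1 ++ h] for a unique [c] and [h].  Its block
    multiset is [c] (when [c > 0]) together with two copies of the blocks of [h];
    so [c] is the only block length of odd multiplicity, and the block multiset
    of the palindrome determines both [c] and the block multiset of [h].  Sorting
    on [c] (either [c < k] and [h] attains [k], or [c = k]) gives the sums. *)

(** * Counting equivalence classes as distinct sorted block lists *)

Lemma card_equivalence_partition_kernel (T : finType) (U : eqType)
    (f : T -> U) (R : rel T) (D : {set T}) :
  (forall x y, R x y = (f x == f y)) ->
  #|equivalence_partition R D| = size (undup [seq f x | x <- enum D]).
Proof.
move=> Rf; pose K (u : U) := [set y in D | u == f y].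
have -> : equivalence_partition R D = [set K (f x) | x in D].
  by apply: eq_imset => x; apply/setP=> y; rewrite !inE Rf.
(* A class is a fibre of [f] in [D]; an attained value is recovered from any point of its fibre. *)
have Kinj : {in [seq f x | x <- enum D] &, injective K}.
  move=> u v /mapP[x]; rewrite mem_enum => Dx -> /mapP[y _ ->] /setP/(_ x).
  by rewrite !inE Dx eqxx /= => /esym/eqP.
have -> : #|[set K (f x) | x in D]| = size (undup [seq K (f x) | x <- enum D]).
  rewrite -(card_uniqP (undup_uniq _)); apply: eq_card => A.
  rewrite mem_undup; apply/imsetP/mapP => [] [x Dx ->]; exists x => //.
    by rewrite mem_enum.
  by rewrite -mem_enum.
rewrite (map_comp K f) -(size_map K (undup _)).
apply: perm_size; apply: uniq_perm; rewrite ?undup_uniq //.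
  by rewrite map_inj_in_uniq ?undup_uniq // => u v; rewrite !mem_undup; apply: Kinj.
move=> A; rewrite mem_undup.
by apply/mapP/mapP => [] [u Du ->]; exists u; rewrite // ?mem_undup // -mem_undup.
Qed.

(** Sorting picks a canonical representative of the multiset, so that [same_blocks] becomes an
    equality. *)
Definition block_type (s : seq bool) : seq nat := sort leq (zero_blocks s).

Definition block_types {m : nat} (D : {set m.-tuple bool}) : seq (seq nat) :=
  undup [seq block_type X | X : m.-tuple bool <- enum D].

Lemma same_blocksE m (X Y : m.-tuple bool) :
  same_blocks X Y = (block_type X == block_type Y).
Proof.
apply/idP/eqP; rewrite /same_blocks.
  by move/(perm_sortP leq_total leq_trans anti_leq).
by move=> e; apply/(perm_sortP leq_total leq_trans anti_leq).
Qed.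

Lemma P_block_types m y j : P m.+1 y j = size (block_types (B m y j)).
Proof.
exact: (card_equivalence_partition_kernel _ _ (fun X : m.-tuple bool => block_type X)
          _ _ (@same_blocksE m)).
Qed.

Lemma Phat_block_types m y j : Phat m.+1 y j = size (block_types (Bhat m y j)).
Proof.
exact: (card_equivalence_partition_kernel _ _ (fun X : m.-tuple bool => block_type X)
          _ _ (@same_blocksE m)).
Qed.

Lemma block_types_BP m y j t :
  reflect (exists s, [/\ size s = m, num_zeros s = y,
                        longest_zero_block s = j & t = block_type s])
          (t \in block_types (B m y j)).
Proof.
rewrite mem_undup; apply: (iffP mapP).
  case=> X; rewrite mem_enum inE => /andP[/eqP zX /eqP lX] ->.
  by exists X; rewrite size_tuple.
case=> s [sz zs ls ->]; have sm : size s == m by apply/eqP.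
by exists (Tuple sm); rewrite // mem_enum inE /= zs ls !eqxx.
Qed.

Lemma block_types_BhatP m y j t :
  reflect (exists s, [/\ size s = m, num_zeros s = y,
                        longest_zero_block s = j & t = block_type s] /\ rev s = s)
          (t \in block_types (Bhat m y j)).
Proof.
rewrite mem_undup; apply: (iffP mapP).
  case=> X; rewrite mem_enum !inE => /andP[/andP[/eqP zX /eqP lX] /eqP pX] ->.
  by exists X; rewrite size_tuple.
case=> s [[sz zs ls ->] ps]; have sm : size s == m by apply/eqP.
by exists (Tuple sm); rewrite // mem_enum !inE /= zs ls ps !eqxx.
Qed.

(** * Blocks of concatenations and reversals *)

Lemma zero_blocks_from_cat1 c s t :
  zero_blocks_from c (s ++ true :: t) = zero_blocks_from c s ++ zero_blocks t.
Proof.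
elim: s c => [|[] s IHs] c /=; rewrite ?IHs //; first by case: eqP.
by case: eqP.
Qed.

Lemma zero_blocks_cat1 s t :
  zero_blocks (s ++ true :: t) = zero_blocks s ++ zero_blocks t.
Proof. exact: zero_blocks_from_cat1. Qed.

Lemma zero_blocks_nseq c : zero_blocks (nseq c false) = nseq (c != 0) c.
Proof.
have E d : zero_blocks_from d (nseq c false) = nseq (c + d != 0) (c + d).
  elim: c d => [|c IHc] d /=; first by case: d.
  by rewrite IHc addnS.
by rewrite /zero_blocks E addn0.
Qed.

Lemma bool_seq_split s :
  s = nseq (size s) false \/ exists a t, s = nseq a false ++ true :: t.
Proof.
elim: s => [|[] s IHs] /=; first by left.
  by right; exists 0, s.
case: IHs => [{1}->|[a [t ->]]]; first by left.
by right; exists a.+1, t.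
Qed.

Lemma zero_blocks_rev s : zero_blocks (rev s) = rev (zero_blocks s).
Proof.
(* Strong induction on the length: each step removes the leading zeros together with the one that
   ends them. *)
have [n le_sn] := ubnP (size s); elim: n s le_sn => // n IHn s le_sn.
case: (bool_seq_split s) => [->|[a [t es]]].
  by rewrite rev_nseq zero_blocks_nseq rev_nseq.
rewrite es in le_sn *.
rewrite rev_cat rev_cons cat_rcons !zero_blocks_cat1 rev_nseq rev_cat IHn.
  by rewrite zero_blocks_nseq rev_nseq.
by move: le_sn; rewrite size_cat /=; lia.
Qed.

(** * Palindromes with a given centre and half *)

Definition palindrome (c : nat) (h : seq bool) : seq bool :=
  rev h ++ true :: nseq c false ++ true :: h.

Definition palindrome_type (c : nat) (t : seq nat) : seq nat :=
  sort leq (nseq (c != 0) c ++ t ++ t).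

Lemma rev_palindrome c h : rev (palindrome c h) = palindrome c h.
Proof.
by rewrite /palindrome rev_cat rev_cons rev_cat rev_cons revK rev_nseq !cat_rcons -catA.
Qed.

Lemma size_palindrome c h : size (palindrome c h) = c + 2 * size h + 2.
Proof. by rewrite !size_cat /= size_cat /= size_rev size_nseq; lia. Qed.

Lemma num_zeros_palindrome c h :
  num_zeros (palindrome c h) = c + 2 * num_zeros h.
Proof.
rewrite /num_zeros count_cat /= count_cat /= count_rev count_nseq /=; lia.
Qed.

Lemma perm_palindrome_blocks c h :
  perm_eq (zero_blocks (palindrome c h))
          (nseq (c != 0) c ++ zero_blocks h ++ zero_blocks h).
Proof.
rewrite !zero_blocks_cat1 zero_blocks_nseq zero_blocks_rev.
by rewrite perm_catCA !perm_cat2l perm_cat2r perm_rev.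
Qed.

Lemma block_type_palindrome c h :
  block_type (palindrome c h) = palindrome_type c (block_type h).
Proof.
apply/(perm_sortP leq_total leq_trans anti_leq).
rewrite (perm_trans (perm_palindrome_blocks c h)) // perm_cat2l.
by apply: perm_cat; rewrite perm_sym perm_sort.
Qed.

Lemma longest_palindrome c h :
  longest_zero_block (palindrome c h) = maxn c (longest_zero_block h).
Proof.
rewrite /longest_zero_block (perm_big _ (perm_palindrome_blocks c h)) !big_cat /=.
rewrite maxnn; congr maxn.
by case: c => [|c]; rewrite ?big_nil ?big_seq1.
Qed.

Lemma count_palindrome_type v c t : 0 < v ->
  count_mem v (palindrome_type c t) = (c == v) + 2 * count_mem v t.
Proof.
move=> v_gt0; rewrite count_sort !count_cat count_nseq /=.
by case: eqP => [->|_]; lia.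
Qed.

Lemma palindrome_type_center c c' t t' :
  palindrome_type c t = palindrome_type c' t' -> c = c'.
Proof.
move=> e.
(* Multiplicities are compared modulo 2. This sees positive lengths only, so a zero centre is
   treated apart below. *)
have E v : 0 < v -> (c == v) = (c' == v).
  move=> v_gt0; have := congr1 (count_mem v) e.
  by rewrite !count_palindrome_type //; case: eqP; case: eqP => //; lia.
case: c {e} E => [|c] E; last by apply/esym/eqP; rewrite -E.
by case: c' E => // c' /(_ c'.+1 isT); rewrite eqxx.
Qed.

(** The common centre cancels, and the doubled multiplicities can be halved. *)
Lemma palindrome_type_inj c t t' : sorted leq t -> sorted leq t' ->
  palindrome_type c t = palindrome_type c t' -> t = t'.
Proof.
move=> st st' /(perm_sortP leq_total leq_trans anti_leq).
rewrite perm_cat2l => /permP e; apply: (sorted_eq leq_trans anti_leq) => //.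
by apply/permP => a; have := e a; rewrite !count_cat; lia.
Qed.

Lemma palindromeP s : rev s = s -> num_zeros s < size s ->
  odd (num_zeros s) = odd (size s) -> exists c h, s = palindrome c h.
Proof.
(* [g] is the right half, without the middle letter when the length is odd. *)
move=> ps lt_zs par; pose a := (size s)./2; pose g := drop (uphalf (size s)) s.
have le_as : a <= uphalf (size s) by rewrite /a; lia.
have revg : take a s = rev g.
  by rewrite -{1}ps take_rev; congr (rev (drop _ _)); rewrite /a; lia.
have es : s = rev g ++ nseq (odd (size s)) false ++ g.
  rewrite -revg; case: (boolP (odd (size s))) => so; last first.
    rewrite /= -{1}(cat_take_drop a s); congr (_ ++ drop _ _).
    by rewrite /a; lia.
  have lt_as : a < size s by rewrite /a; lia.
  have eu : uphalf (size s) = a.+1 by rewrite /a; lia.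
  have e0 : s = take a s ++ nth false s a :: g.
    by rewrite /g eu -drop_nth // cat_take_drop.
  have: nth false s a = false; last by move=> e1; rewrite {1}e0 e1.
  (* A middle one would leave an even number of zeros, against the parity hypothesis. *)
  move: par e0; rewrite so revg; case: nth => // + e0.
  by rewrite e0 /num_zeros count_cat /= count_rev add0n oddD addbb.
have: g != nseq (size g) false.
  apply: contraL lt_zs => /eqP eg; rewrite -leqNgt {1}es es eg.
  by rewrite /num_zeros rev_nseq !count_cat !size_cat !count_nseq !size_nseq /=; lia.
case: (bool_seq_split g) => [->|[b [h eg]] _]; first by rewrite size_nseq eqxx.
(* The central block is made of the [b] leading zeros of [g], their mirror image and the middle
   zero, if any. *)
exists (b + odd (size s) + b), h; rewrite {1}es eg.
rewrite /palindrome rev_cat rev_cons rev_nseq cat_rcons -catA /=.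
by rewrite !nseqD -!catA.
Qed.

(** * Summing over the central block *)

Lemma maxn_eqE c j k :
  (maxn c j == k) = (c < k) && (j == k) || (c == k) && (j <= k).
Proof. lia. Qed.

(* The pairs (c, j) of a central block length and a longest block of the half
   that make the longest block of the palindrome equal to k. *)
Definition center_longest (x k : nat) : seq (nat * nat) :=
  [seq (c, k) | c <- iota 0 k & odd c == odd x] ++
  (if odd k == odd x then [seq (k, j) | j <- iota 0 k.+1] else [::]).

Lemma mem_center_longest x k c j :
  ((c, j) \in center_longest x k) = (odd c == odd x) && (maxn c j == k).
Proof.
rewrite mem_cat maxn_eqE; apply/orP/andP.
  case=> [/mapP[d]|].
    by rewrite mem_filter mem_iota => /andP[od lt_dk] [-> ->]; lia.
  case: eqP => // ok /mapP[i]; rewrite mem_iota => lt_i [-> ->]; lia.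
case=> oc /orP[/andP[lt_ck /eqP->]|/andP[/eqP<- le_jk]].
  by left; apply/mapP; exists c; rewrite // mem_filter mem_iota oc; lia.
by right; rewrite oc; apply/mapP; exists j; rewrite // mem_iota; lia.
Qed.

Lemma center_longest_uniq x k : uniq (center_longest x k).
Proof.
rewrite cat_uniq map_inj_uniq ?filter_uniq ?iota_uniq //; last by move=> c d [].
case: ifP => // _; rewrite map_inj_uniq ?iota_uniq; last by move=> i j [].
rewrite andbT; apply/hasPn => _ /mapP[j _ ->].
by apply/mapP => -[c]; rewrite mem_filter mem_iota => /andP[_ lt_ck] [ck _]; lia.
Qed.

Lemma Phat_center m x k : x < m -> odd x = odd m -> k <= x ->
  Phat m.+1 x k =
    \sum_(0 <= c < k | odd c == odd x) P ((m - c)./2) ((x - c)./2) k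
    + (if odd k == odd x
       then \sum_(0 <= j < k.+1) P ((m - k)./2) ((x - k)./2) j else 0).
Proof.
move=> lt_xm par le_kx.
(* Types of the possible halves; the 2 accounts for the two ones around the centre. *)
pose L (p : nat * nat) := block_types (B ((m - p.1 - 2)./2) ((x - p.1)./2) p.2).
have LP c j : c <= k -> odd c = odd x ->
    size (L (c, j)) = P ((m - c)./2) ((x - c)./2) j.
  move=> le_ck oc; have -> : (m - c)./2 = ((m - c - 2)./2).+1 by lia.
  by rewrite P_block_types.
transitivity (\sum_(p <- center_longest x k) size (L p)); last first.
  rewrite big_cat big_map big_filter; congr (_ + _).
    rewrite /index_iota subn0 big_seq_cond [RHS]big_seq_cond.
    apply: eq_bigr => c /andP[]; rewrite mem_iota => lt_ck /eqP oc.
    by rewrite LP //; lia.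
  case: eqP => [ok|_]; last by rewrite big_nil.
  by rewrite big_map /index_iota subn0; apply: eq_bigr => j _; rewrite LP.
rewrite Phat_block_types.
pose F (p : nat * nat) t := palindrome_type p.1 t.
transitivity (size [seq F p t | p <- center_longest x k, t <- L p]); last first.
  by rewrite size_allpairs_dep sumnE big_map.
apply: perm_size; apply: uniq_perm; first exact: undup_uniq.
  (* No type is listed twice: it determines the centre, then the type of the half, hence also the
     longest block of the half. *)
  apply: allpairs_uniq_dep => [|p _|]; rewrite ?center_longest_uniq ?undup_uniq //.
  move=> _ _ /allpairsPdep[[c j] [t [_ Lt ->]]] /allpairsPdep[[c' j'] [t' [_ Lt' ->]]].
  rewrite /F /= => e.
  case/block_types_BP: Lt => h /= [_ _ <- et].
  case/block_types_BP: Lt' => h' /= [_ _ <- et'].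
  have ec := palindrome_type_center _ _ _ _ e; rewrite -{c'}ec in e *.
  have {e} ett : t = t'.
    by apply: palindrome_type_inj e; rewrite ?et ?et' (sort_sorted leq_total).
  have -> : longest_zero_block h = longest_zero_block h'.
    apply: perm_big; apply/(perm_sortP leq_total leq_trans anti_leq).
    by move: ett; rewrite et et'.
  by rewrite ett.
move=> u; apply/block_types_BhatP/allpairsPdep.
  case=> s [[sz zs ls ->] ps].
  have [||c [h es]] := palindromeP _ ps; rewrite ?sz ?zs //.
  move: sz zs ls; rewrite {}es size_palindrome num_zeros_palindrome longest_palindrome.
  move=> sz zs ls.
  exists (c, longest_zero_block h), (block_type h); split.
  - by rewrite mem_center_longest ls eqxx andbT; lia.
  - by apply/block_types_BP; exists h; split=> //=; lia.
  - by rewrite block_type_palindrome.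
case=> [[c j] [t [cj Lt ->]]]; move: cj; rewrite mem_center_longest => /andP[oc mx].
case/block_types_BP: Lt => h /= [sh zh lh ->]; exists (palindrome c h).
rewrite rev_palindrome size_palindrome num_zeros_palindrome longest_palindrome.
rewrite block_type_palindrome; split=> //; split=> //; lia.
Qed.

(** Substitutes [c = 2 * i + b]; the new bound is the number of [c < k] of parity [b]. *)
Lemma sum_same_parity (b : bool) k (F : nat -> nat) :
  \sum_(0 <= c < k | odd c == b) F c =
  \sum_(0 <= i < (k + ~~ b)./2) F (2 * i + b).
Proof.
elim: k => [|k IHk]; first by case: b; rewrite !big_geq.
rewrite big_mkcond big_nat_recr // -big_mkcond IHk.
case: eqP => ok.
  have -> : (k.+1 + ~~ b)./2 = ((k + ~~ b)./2).+1 by case: b ok {IHk}; lia.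
  rewrite big_nat_recr //=; congr (_ + F _); case: b ok {IHk}; lia.
by rewrite /= addn0; congr (\sum_(0 <= i < _) _); case: b ok {IHk}; lia.
Qed.

Theorem theorem5p9 (n x k : nat) :
  (odd x -> 4 <= x <= 2 * n -> 3 <= k <= x - 2 ->
    Phat (2 * n + 2) x k =
      \sum_(0 <= i < k %/ 2) P (n - i) ((x - 2 * i - 1) %/ 2) k
      + (if odd k
         then \sum_(0 <= j < k.+1) P ((2 * n - k + 1) %/ 2) ((x - k) %/ 2) j
         else 0))
  /\
  (~~ odd x -> 4 <= x <= 2 * n - 1 -> 3 <= k <= x - 2 ->
    Phat (2 * n + 1) x k =
      \sum_(0 <= i < ((k - 1) %/ 2).+1) P (n - i) ((x - 2 * i) %/ 2) k
      + (if odd k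
         then 0
         else \sum_(0 <= j < k.+1) P ((2 * n - k) %/ 2) ((x - k) %/ 2) j)).
Proof.
split=> ox hx hk.
  (* Strings of length [m = 2 * n + 1]; with [c = 2 * i + 1] the index [(m - c)./2] is [n - i]. *)
  rewrite addnS Phat_center; [|lia..].
  rewrite sum_same_parity ox eqb_id addn0 divn2; congr (_ + _).
    by apply: eq_big_nat => i lt_i; congr P; lia.
  by case: ifP => // ok; apply: eq_bigr => j _; congr P; lia.
(* Here [m = 2 * n] and [c = 2 * i]. *)
rewrite addn1 Phat_center; [|lia..].
rewrite sum_same_parity (negbTE ox) eqbF_neg addn1; congr (_ + _).
  have -> : k.+1./2 = ((k - 1) %/ 2).+1 by lia.
  by apply: eq_big_nat => i lt_i; congr P; lia.
by case: (odd k) => //=; apply: eq_bigr => j _; congr P; lia.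
Qed.
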